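(* Let $K$ be a field of characteristic $0$, $G$ a finite abelian group, and $\rho:\mathsf G\to\mathsf E$ a graded map on $\mathsf G$. If $\rho$ has the induction property (IP), then $\mathcal E(\rho)$ is a subalgebra of $(K[\mathsf G],* )$.
   Context: $G_n=G^n\rtimes\mathfrak S_n$ is the wreath product; its elements are written $\sigma^{\mathbf g}=\sigma\cdot(g_1,\dots,g_n)$ and identified with coloured words $\sigma(1)^{g_1}\cdots\sigma(n)^{g_n}$; for $\tau\in\mathfrak S_n\subseteq G_n$ (trivial colours), $\tau\sigma^{\mathbf g}=(\tau\sigma)^{\mathbf g}$. $\mathsf G=\bigsqcup_{n\ge0}G_n$, $K[\mathsf G]=\bigoplus_{n\ge0}KG_n$. For $\sigma\in\mathfrak S_n$, $\tau\in\mathfrak S_m$, $\sigma\times\tau\in\mathfrak S_{n+m}$ maps $a\in[1,n]$ to $\sigma(a)$ and $n+b$ to $n+\tau(b)$; $\sigma^{\mathbf g}\times\tau^{\mathbf h}=(\sigma\times\tau)^{\mathbf g\cdot\mathbf h}$ (colour sequences concatenated). $X_{(n,m)}$ is the set of $u\in\mathfrak S_{n+m}$ increasing on $[1,n]$ and on $[n+1,n+m]$. The product is $\alpha*\beta=\sum_{u\in X_{(n,m)}}u(\alpha\times\beta)$ for $\alpha\in G_n$, $\beta\in G_m$; its unit is the unique element of $G_0$. A graded set is $\mathsf E=\bigsqcup_nE_n$; a graded map $\rho:\mathsf G\to\mathsf E$ satisfies $\rho(G_n)\subseteq E_n$. For $e\in E_n$, $\mathsf b^\rho_e=\sum_{\alpha\in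 G_n,\ \rho(\alpha)=e}\alpha$; $\mathcal E(\rho)=\bigoplus_n\mathcal E(\rho)_n$, where $\mathcal E(\rho)_n$ is the span of $\{\mathsf b^\rho_e:e\in E_n\}$. (IP): for any $n,m\in\mathbb{N}$ and $(e_n,e_m)\in E_n\times E_m$ there is $X\subseteq E_{n+m}$ such that $\{u(\alpha\times\beta):u\in X_{(n,m)},\ \alpha\in G_n,\ \rho(\alpha)=e_n,\ \beta\in G_m,\ \rho(\beta)=e_m\}=\bigsqcup_{e\in X}\rho^{-1}(e)$. *)

(* Defs.v *)
From HB Require Import structures.
From mathcomp Require Import all_boot all_order all_algebra all_fingroup.
From mathcomp Require Import boolp classical_sets.
From mathcomp Require Import finmap.
From mathcomp Require Import monalg.

Set Implicit Arguments.
Unset Strict Implicit.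
Unset Printing Implicit Defensive.

Import GRing.Theory.
Local Open Scope classical_set_scope.
Local Open Scope ring_scope.

Section Wreath.
Variables (gT : finGroupType) (n : nat).

(* The coloured permutation sigma . (g_1, ..., g_n), i.e. the coloured word
   sigma(1)^{g_1} ... sigma(n)^{g_n}, is the pair (sigma, g).  The alias keeps
   the direct-product group structure of pairs from being inferred. *)
Definition wreath : Type := ('S_n * {ffun 'I_n -> gT})%type.

HB.instance Definition _ := Finite.on wreath.

Implicit Types a b c : wreath.

(* sigma^g acts on [1,n] x G by (i, x) |-> (sigma i, g_i x), and the product is
   composition of such maps.  Permutations compose from right to left here,
   whereas (s * t)%g in 'S_n applies s first: sigma tau is (tau * sigma)%g. *)
Definition wreath_one : wreath := (1%g, [ffun=> 1%g]).
Definition wreath_mul a b : wreath :=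
  ((b.1 * a.1)%g, [ffun i => (a.2 (b.1 i) * b.2 i)%g]).
Definition wreath_inv a : wreath :=
  (a.1^-1%g, [ffun i => (a.2 (a.1^-1%g i))^-1%g]).

Lemma wreath_mulA : associative wreath_mul.
Proof.
move=> a b c; congr pair => /=; first by rewrite mulgA.
by apply/ffunP => i; rewrite !ffunE permM mulgA.
Qed.

Lemma wreath_mul1 : left_id wreath_one wreath_mul.
Proof.
case=> s g; congr pair => /=; first by rewrite mulg1.
by apply/ffunP => i; rewrite !ffunE mul1g.
Qed.

Lemma wreath_mulV : left_inverse wreath_one wreath_inv wreath_mul.
Proof.
case=> s g; congr pair => /=; first by rewrite mulgV.
by apply/ffunP => i; rewrite !ffunE permK mulVg.
Qed.

HB.instance Definition _ :=
  Finite_isGroup.Build wreath wreath_mulA wreath_mul1 wreath_mulV.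

Definition perm_wreath (s : 'S_n) : wreath := (s, [ffun=> 1%g]).

Lemma perm_wreath_mul (s : 'S_n) (a : wreath) :
  (perm_wreath s * a)%g = ((a.1 * s)%g, a.2) :> wreath.
Proof. by congr pair; apply/ffunP => i; rewrite !ffunE mul1g. Qed.

End Wreath.

Section Times.
Variables n m : nat.

Definition perm_times_fun (s : 'S_n) (t : 'S_m) (i : 'I_(n + m)) : 'I_(n + m) :=
  match split i with
  | inl a => lshift m (s a)
  | inr b => rshift n (t b)
  end.

Lemma perm_times_inj s t : injective (perm_times_fun s t).
Proof.
move=> i j; rewrite /perm_times_fun -{2}(splitK i) -{2}(splitK j).
case: (split i) => a; case: (split j) => b /= /eqP.
- by rewrite eq_lshift => /eqP/perm_inj->.
- by rewrite eq_lrshift.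
- by rewrite eq_rlshift.
- by rewrite eq_rshift => /eqP/perm_inj->.
Qed.

Definition perm_times s t : 'S_(n + m) := perm (@perm_times_inj s t).

Definition wreath_times (gT : finGroupType) (a : wreath gT n) (b : wreath gT m)
    : wreath gT (n + m) :=
  (perm_times a.1 b.1,
   [ffun i => match split i with inl j => a.2 j | inr k => b.2 k end]).

(* the set X_(n,m) *)
Definition shuffles : {set 'S_(n + m)} :=
  [set u : 'S_(n + m) |
    [forall i : 'I_n, forall j : 'I_n,
       (i < j)%N ==> (u (lshift m i) < u (lshift m j))%N] &&
    [forall i : 'I_m, forall j : 'I_m,
       (i < j)%N ==> (u (rshift n i) < u (rshift n j))%N]]%SET.

End Times.

Section Algebra.
Variables (K : fieldType) (gT : finGroupType).

Definition graded_wreath : Type := {n : nat & wreath gT n}.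

HB.instance Definition _ := Choice.on graded_wreath.

Definition coloured n (a : wreath gT n) : graded_wreath :=
  Tagged (wreath gT) a.

(* K[G] is the space of finitely supported functions on the disjoint union of
   the G_n, i.e. the direct sum of the K G_n; <<x>> is the basis element x. *)
Local Notation KG := {malg K[graded_wreath]}.

Definition star_basis (x y : graded_wreath) : KG :=
  \sum_(u in shuffles (tag x) (tag y))
    << coloured (perm_wreath gT u * wreath_times (tagged x) (tagged y))%g >>.

Definition star (f g : KG) : KG :=
  \sum_(x <- msupp f) \sum_(y <- msupp g) (f@_x * g@_y) *: star_basis x y.

Definition star_one : KG := << coloured (1%g : wreath gT 0) >>.

End Algebra.

Section Subspaces.
Variables (K : fieldType) (V : lmodType K).

Definition lin_span (S : set V) : set V :=
  [set x | exists s : seq (K * V),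
     (forall p, p \in s -> S p.2) /\ x = \sum_(p <- s) p.1 *: p.2].

Definition sum_subspaces (W : nat -> set V) : set V :=
  [set x | exists N (y : nat -> V),
     (forall n, W n (y n)) /\ x = \sum_(n < N) y n].

(* what GRing.subalg_closed unfolds to, for an explicit unit and product *)
Definition is_subalgebra (one : V) (mul : V -> V -> V) (A : set V) : Prop :=
  [/\ A one,
      forall c x y, A x -> A y -> A (c *: x + y)
    & forall x y, A x -> A y -> A (mul x y)].

End Subspaces.

(* A graded set is a family E of arbitrary types, and a graded map on the
   disjoint union of the G_n is a family of maps G_n -> E_n. *)
Section GradedMap.
Variables (K : fieldType) (gT : finGroupType).
Variables (E : nat -> Type) (rho : forall n, wreath gT n -> E n).

Definition b_rho n (e : E n) : {malg K[graded_wreath gT]} :=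
  \sum_(a : wreath gT n | `[< rho a = e >]) << coloured a >>.

Definition E_rho_comp n : set {malg K[graded_wreath gT]} :=
  lin_span (range (@b_rho n)).

(* The sum is direct: E_rho_comp n is contained in K G_n. *)
Definition E_rho : set {malg K[graded_wreath gT]} := sum_subspaces E_rho_comp.

Definition induction_property : Prop :=
  forall (n m : nat) (en : E n) (em : E m), exists X : set (E (n + m)),
    [set x | exists (u : 'S_(n + m)) (a : wreath gT n) (b : wreath gT m),
       [/\ u \in shuffles n m, rho a = en, rho b = em
         & x = (perm_wreath gT u * wreath_times a b)%g]]
    = \bigcup_(e in X) (@rho (n + m) @^-1` [set e]).

End GradedMap.

Arguments star {K gT}.
Arguments star_one {K gT}.
Arguments E_rho K {gT E}.

(* Main.v *)
Require Import Defs.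
From HB Require Import structures.
From mathcomp Require Import all_boot all_order all_algebra all_fingroup.
From mathcomp Require Import boolp classical_sets finmap monalg.
Set Implicit Arguments.
Unset Strict Implicit.
Unset Printing Implicit Defensive.

(** Let u be a shuffle and a x b a concatenation of coloured words.  The
    colours of u(a x b) determine those of a and b, and its values on
    the first block are u(1), ..., u(n) in some order; since u is increasing on
    the block, the set of these values determines u there and their order
    determines the permutation underlying a.  The same holds on the second
    block, so (u, a, b) |-> u(a x b) is injective on shuffles
    ([shuffle_factorisation_inj]).

    By bilinearity, b_e * b_e' is the sum of u(a x b) over all shuffles u and
    all a, b in the fibres over e and e'.  Injectivity says that no word occurs
    twice in this sum, so it is the plain sum of the elements of a set of words,
    and the induction property says that this set is a union of fibres of rho.
    The sum over a union of fibres is a sum of elements b_e''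
    ([E_rho_fibre_union]), hence products of generators stay in the span
    ([E_rho_star_b]).  Two applications of linearity ([E_rho_linear_image])
    extend this to all products, and the unit is b_e for e the image under rho
    of the only element of G_0. *)

Import GRing.Theory.
Local Open Scope ring_scope.

(** * Unique factorisation through shuffles *)

(** The permutation p = s' s^-1 satisfies v = v' o p, so it is increasing.  An
    increasing self-map of an initial segment never lies below the identity;
    applying v' gives the inequality. *)
Lemma increasing_parametrisations_le n (v v' : 'I_n -> nat) (s s' : 'S_n) :
    (forall i j : 'I_n, (i < j)%N -> (v i < v j)%N) ->
    (forall i j : 'I_n, (i < j)%N -> (v' i < v' j)%N) ->
    (forall i, v (s i) = v' (s' i)) ->
  forall i, (v' i <= v i)%N.
Proof.
move=> v_inc v'_inc vs_v's'.
pose p i := s' (s^-1 i)%g.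
have v_p i : v i = v' (p i) by rewrite -vs_v's' permKV.
have p_inc (i j : 'I_n) : (i < j)%N -> (p i < p j)%N.
  move=> /v_inc; rewrite !v_p => lt_v'; rewrite ltnNge.
  apply: contraL lt_v'; rewrite -leqNgt.
  by rewrite leq_eqVlt => /predU1P[/val_inj-> // | /v'_inc/ltnW].
have le_p k : forall i : 'I_n, i = k :> nat -> (i <= p i)%N.
  elim: k => [|k IHk] i ik; first by rewrite ik.
  have lt_kn : (k < n)%N by rewrite ltnW // -ik.
  rewrite ik (leq_ltn_trans (IHk (Ordinal lt_kn) erefl)) //.
  by apply: p_inc; rewrite ik.
move=> i; rewrite v_p; have := le_p i i erefl.
by rewrite leq_eqVlt => /predU1P[/val_inj<- // | /v'_inc/ltnW].
Qed.

(** A finite set of integers has only one increasing enumeration: v and v' have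
    the same image, so the previous inequality holds in both directions. *)
Lemma increasing_parametrisations_unique n (v v' : 'I_n -> nat) (s s' : 'S_n) :
    (forall i j : 'I_n, (i < j)%N -> (v i < v j)%N) ->
    (forall i j : 'I_n, (i < j)%N -> (v' i < v' j)%N) ->
    (forall i, v (s i) = v' (s' i)) ->
  v =1 v' /\ s = s'.
Proof.
move=> v_inc v'_inc vs_v's'.
have v_v' : v =1 v'.
  move=> i; apply/eqP; rewrite eqn_leq.
  rewrite (increasing_parametrisations_le v_inc v'_inc vs_v's') andbT.
  exact: (increasing_parametrisations_le v'_inc v_inc (fsym vs_v's')).
split=> //; apply/permP=> i; have := vs_v's' i; rewrite -v_v'.
case: (ltngtP (s i) (s' i)) => [/v_inc | /v_inc | /val_inj //];
  by move=> lt_v eq_v; rewrite eq_v ltnn in lt_v.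
Qed.

(** Restricted to either block, u(a x b) enumerates an increasing function in
    the order given by the permutation of a (or of b), and such an expression
    is unique.  Colours are not affected by u, so they can be read off. *)
Lemma shuffle_factorisation_inj (gT : finGroupType) n m (u u' : 'S_(n + m))
    (a a' : wreath gT n) (b b' : wreath gT m) :
    u \in shuffles n m -> u' \in shuffles n m ->
    (perm_wreath gT u * wreath_times a b)%g
      = (perm_wreath gT u' * wreath_times a' b')%g ->
  [/\ u = u', a = a' & b = b'].
Proof.
case: a a' b b' => [s f] [s' f'] [t h] [t' h'].
rewrite !inE => /andP[/'forall_'forall_implyP uL /'forall_'forall_implyP uR].
move=> /andP[/'forall_'forall_implyP u'L /'forall_'forall_implyP u'R].
rewrite !perm_wreath_mul => -[/= /permP eq_perm /ffunP eq_col].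
(* Evaluating both words on one block at a time reduces the claim to each
   pair of factors separately. *)
have splitL (i : 'I_n) : split (lshift m i) = inl i := unsplitK (inl _ i).
have splitR (i : 'I_m) : split (rshift n i) = inr i := unsplitK (inr _ i).
have -> : f = f'.
  by apply/ffunP=> i; have := eq_col (lshift m i); rewrite !ffunE splitL.
have -> : h = h'.
  by apply/ffunP=> i; have := eq_col (rshift n i); rewrite !ffunE splitR.
have [i | u_L ->] :=
  @increasing_parametrisations_unique n (u \o lshift m) (u' \o lshift m)
    s s' uL u'L.
  have := eq_perm (lshift m i).
  by rewrite !permM !permE /perm_times_fun splitL /= => ->.
have [i | u_R ->] :=
  @increasing_parametrisations_unique m (u \o @rshift n m) (u' \o @rshift n m)
    t t' uR u'R.
  have := eq_perm (rshift n i).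
  by rewrite !permM !permE /perm_times_fun splitR /= => ->.
split=> //; apply/permP=> i; rewrite -(splitK i); apply: val_inj.
by case: (split i) => j; [exact: u_L | exact: u_R].
Qed.

(** * Bilinearity of the product *)

(** The linear extension of F from the basis elements to all of K[T].  The
    product [star] is two nested extensions, which gives its bilinearity. *)
Definition lin_ext (K : fieldType) (T : choiceType) (V : lmodType K)
    (F : T -> V) (f : {malg K[T]}) : V :=
  \sum_(x <- msupp f) f@_x *: F x.

(** Two elements may have different supports, so additivity is proved on a
    common finite set containing both. *)
Lemma lin_ext_widen (K : fieldType) (T : choiceType) (V : lmodType K)
    (F : T -> V) (D : {fset T}) (f : {malg K[T]}) :
  (msupp f `<=` D)%fset -> lin_ext F f = \sum_(x <- D) f@_x *: F x.
Proof.
move=> sfD; apply: big_fset_incl => // x _ /mcoeff_outdom->.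
exact: scale0r.
Qed.

Lemma lin_ext_linear (K : fieldType) (T : choiceType) (V : lmodType K)
    (F : T -> V) : linear (lin_ext F).
Proof.
move=> c f g; pose D := (msupp f `|` msupp g)%fset.
have sfD : (msupp f `<=` D)%fset by apply: fsubsetUl.
have sgD : (msupp g `<=` D)%fset by apply: fsubsetUr.
have sD : (msupp (c *: f + g) `<=` D)%fset.
  by apply: fsubset_trans (msuppD_le _ _) _; rewrite fsetSU // msuppZ_le.
rewrite !(lin_ext_widen _ sfD, lin_ext_widen _ sgD, lin_ext_widen _ sD).
rewrite scaler_sumr -big_split; apply: eq_bigr => x _ /=.
by rewrite mcoeffD mcoeffZ scalerDl scalerA.
Qed.

HB.instance Definition _ (K : fieldType) (T : choiceType) (V : lmodType K)
    (F : T -> V) :=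
  GRing.isLinear.Build K {malg K[T]} V _ (lin_ext F) (lin_ext_linear F).

Lemma lin_extU (K : fieldType) (T : choiceType) (V : lmodType K)
    (F : T -> V) (x : T) : lin_ext F << x >> = F x.
Proof.
by rewrite (lin_ext_widen _ msuppU_le) big_seq_fset1 mcoeffUU scale1r.
Qed.

Lemma star_lin_ext (K : fieldType) (gT : finGroupType)
    (f g : {malg K[graded_wreath gT]}) :
  star f g = lin_ext (fun x => lin_ext (star_basis K x) g) f.
Proof.
apply: eq_bigr => x _; rewrite scaler_sumr; apply: eq_bigr => y _.
by rewrite scalerA.
Qed.

Lemma star_linear_l (K : fieldType) (gT : finGroupType)
  (g : {malg K[graded_wreath gT]}) : linear (star^~ g).
Proof. by move=> c f f' /=; rewrite !star_lin_ext linearP. Qed.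

Lemma star_linear_r (K : fieldType) (gT : finGroupType)
  (f : {malg K[graded_wreath gT]}) : linear (star f).
Proof.
move=> c g g'; rewrite !star_lin_ext scaler_sumr -big_split.
apply: eq_bigr => x _ /=.
by rewrite linearP scalerDr !scalerA mulrC.
Qed.

(** * Spans *)

Lemma lin_span_sub (K : fieldType) (V : lmodType K) (S : set V) x :
  S x -> lin_span S x.
Proof.
move=> Sx; exists [:: (1, x)]; split=> [p|]; first by rewrite inE => /eqP->.
by rewrite big_seq1 scale1r.
Qed.

Lemma lin_span0 (K : fieldType) (V : lmodType K) (S : set V) : lin_span S 0.
Proof. by exists [::]; split=> //; rewrite big_nil. Qed.

Lemma lin_spanP (K : fieldType) (V : lmodType K) (S : set V) c x y :
  lin_span S x -> lin_span S y -> lin_span S (c *: x + y).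
Proof.
move=> [s [sS ->]] [t [tS ->]].
exists ([seq (c * p.1, p.2) | p <- s] ++ t); split=> [p|].
  by rewrite mem_cat => /orP[/mapP[q /sS Sq ->] | /tS].
rewrite big_cat big_map scaler_sumr; congr (_ + _).
by apply: eq_bigr => p _; rewrite scalerA.
Qed.

Lemma sum_subspaces_incl (K : fieldType) (V : lmodType K) (W : nat -> set V)
    n x : (forall k, W k 0) -> W n x -> sum_subspaces W x.
Proof.
move=> W0 Wx; exists n.+1, (fun k => if k == n then x else 0); split.
  by move=> k; case: eqP => [->|].
by rewrite big_ord_recr /= eqxx big1 ?add0r // => i _; rewrite ltn_eqF.
Qed.

(** Families of different lengths are added after extension by zero; this is
    where the components have to contain 0. *)
Lemma sum_subspacesP (K : fieldType) (V : lmodType K) (W : nat -> set V) c x y :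
    (forall k, W k 0) ->
    (forall k d v w, W k v -> W k w -> W k (d *: v + w)) ->
  sum_subspaces W x -> sum_subspaces W y -> sum_subspaces W (c *: x + y).
Proof.
move=> W0 WP [N [v [Wv ->]]] [M [w [Ww ->]]].
pose cut L (z : nat -> V) k := if (k < L)%N then z k else 0.
have cutE L (z : nat -> V) P :
    (L <= P)%N -> \sum_(k < L) z k = \sum_(k < P) cut L z k.
  by move=> leLP; rewrite (big_ord_widen _ _ leLP) big_mkcond.
exists (N + M)%N, (fun k => c *: cut N v k + cut M w k); split=> [k|].
  by apply: WP; rewrite /cut; case: ifP.
rewrite (cutE N _ (N + M)%N) ?leq_addr // (cutE M _ (N + M)%N) ?leq_addl //.
by rewrite scaler_sumr -big_split.
Qed.

Lemma E_rho_b (K : fieldType) (gT : finGroupType) (E : nat -> Type)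
    (rho : forall n, wreath gT n -> E n) n (e : E n) :
  E_rho K rho (b_rho K rho e).
Proof.
apply: (@sum_subspaces_incl _ _ _ n) => [k|]; first exact: lin_span0.
by apply: lin_span_sub; exists e.
Qed.

Lemma E_rhoP (K : fieldType) (gT : finGroupType) (E : nat -> Type)
    (rho : forall n, wreath gT n -> E n) c x y :
  E_rho K rho x -> E_rho K rho y -> E_rho K rho (c *: x + y).
Proof.
apply: sum_subspacesP => *; [exact: lin_span0 | exact: lin_spanP].
Qed.

Lemma E_rho0 (K : fieldType) (gT : finGroupType) (E : nat -> Type)
    (rho : forall n, wreath gT n -> E n) : E_rho K rho 0.
Proof.
exists 0%N, (fun=> 0); split=> [n|]; last by rewrite big_ord0.
exact: lin_span0.
Qed.

Lemma E_rho_sum (K : fieldType) (gT : finGroupType) (E : nat -> Type)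
    (rho : forall n, wreath gT n -> E n) (I : Type) (r : seq I) (P : pred I) F :
  (forall i, P i -> E_rho K rho (F i)) -> E_rho K rho (\sum_(i <- r | P i) F i).
Proof.
move=> EF; apply: big_ind => //; first exact: E_rho0.
by move=> x y Ex Ey; rewrite -[x]scale1r; apply: E_rhoP.
Qed.

(** The preimage of E(rho) under a linear map is a subspace, and E(rho) is the
    smallest subspace containing every b_e. *)
Lemma E_rho_linear_image (K : fieldType) (gT : finGroupType) (E : nat -> Type)
    (rho : forall n, wreath gT n -> E n)
    (Phi : {malg K[graded_wreath gT]} -> {malg K[graded_wreath gT]}) :
    linear Phi ->
    (forall n (e : E n), E_rho K rho (Phi (b_rho K rho e))) ->
  forall x, E_rho K rho x -> E_rho K rho (Phi x).
Proof.
move=> Phi_lin Phi_b.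
have Phi0 : E_rho K rho (Phi 0).
  by rewrite -[0](addNr 0) -scaleN1r Phi_lin scaleN1r addNr; apply: E_rho0.
have Phi_closed c x y : E_rho K rho (Phi x) -> E_rho K rho (Phi y) ->
  E_rho K rho (Phi (c *: x + y)) by rewrite Phi_lin; apply: E_rhoP.
have Phi_D x y : E_rho K rho (Phi x) -> E_rho K rho (Phi y) ->
  E_rho K rho (Phi (x + y)) by rewrite -{2}[x]scale1r; apply: Phi_closed.
move=> _ [N [y [Ey ->]]].
apply: (big_ind (fun z => E_rho K rho (Phi z))) => // n _.
have [s [bs ->]] := Ey n.
rewrite big_seq.
apply: (big_ind (fun z => E_rho K rho (Phi z))) => // p /bs[e _ <-].
by rewrite -[X in Phi X]addr0; apply: Phi_closed.
Qed.

(** * Unions of fibres and the product of two fibre sums *)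

(** Grouping the words by their value under rho turns the sum into a sum of
    elements b_e.  The values lie in an arbitrary type, so each fibre is indexed
    by a chosen word in it instead, which makes the index set finite. *)
Lemma E_rho_fibre_union (K : fieldType) (gT : finGroupType) (E : nat -> Type)
    (rho : forall n, wreath gT n -> E n) n (X : set (E n)) :
  E_rho K rho (\sum_(w : wreath gT n | `[< X (rho n w) >]) << coloured w >>).
Proof.
pose rep (w : wreath gT n) : wreath gT n :=
  odflt w [pick w' | `[< rho n w' = rho n w >]].
have rho_rep w : rho n (rep w) = rho n w.
  by rewrite /rep; case: pickP => //= w' /asboolP.
have eq_rep w w' : (rep w == rep w') = `[< rho n w = rho n w' >].
  apply/eqP/asboolP => [rww' | eq_rho]; first by rewrite -rho_rep rww' rho_rep.
  (* [w'] lies in its own fibre, so the default values [w] and [w'], which could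
     differ, are never returned. *)
  rewrite /rep eq_rho; case: pickP => //= /(_ w').
  by move/asboolP; case.
rewrite (partition_big rep predT) //=; apply: E_rho_sum => r _.
have [[w /andP[/asboolP Xw /eqP <-]] | no_w] :=
    pselect (exists w, `[< X (rho n w) >] && (rep w == r)); last first.
  rewrite big_pred0; first exact: E_rho0.
  by move=> w; apply/negP => Xw; apply: no_w; exists w.
rewrite (_ : \sum_(_ | _) _ = b_rho K rho (rho n w)); first exact: E_rho_b.
apply: eq_bigl => w'; rewrite eq_rep; apply: andb_idl => /asboolP ->.
exact/asboolP.
Qed.

Lemma star_b_rho (K : fieldType) (gT : finGroupType) (E : nat -> Type)
    (rho : forall n, wreath gT n -> E n) n m (en : E n) (em : E m) :
  star (b_rho K rho en) (b_rho K rho em)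
    = \sum_(a : wreath gT n | `[< rho n a = en >])
        \sum_(b : wreath gT m | `[< rho m b = em >])
          star_basis K (coloured a) (coloured b).
Proof.
rewrite star_lin_ext linear_sum; apply: eq_bigr => a _ /=.
rewrite lin_extU linear_sum; apply: eq_bigr => b _ /=.
by rewrite lin_extU.
Qed.

(** Reindexing the product along the injection (a, b, u) |-> u(a x b) exhibits
    it as the sum over a union of fibres. *)
Lemma E_rho_star_b (K : fieldType) (gT : finGroupType) (E : nat -> Type)
    (rho : forall n, wreath gT n -> E n) (IP : induction_property rho)
    n m (en : E n) (em : E m) :
  E_rho K rho (star (b_rho K rho en) (b_rho K rho em)).
Proof.
have [X /seteqP[sub_X X_sub]] := IP n m en em.
pose A := [set p : wreath gT n * wreath gT m * 'S_(n + m) |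
  [&& `[< rho n p.1.1 = en >], `[< rho m p.1.2 = em >]
    & p.2 \in shuffles n m]]%SET.
have inA a b u : ((a, b, u) \in A) =
    [&& `[< rho n a = en >], `[< rho m b = em >] & u \in shuffles n m].
  by rewrite !inE.
pose h (p : wreath gT n * wreath gT m * 'S_(n + m)) : wreath gT (n + m) :=
  (perm_wreath gT p.2 * wreath_times p.1.1 p.1.2)%g.
have h_inj : {in A &, injective h}.
  move=> [[a b] u] [[a' b'] u']; rewrite !inA /=.
  move=> /and3P[_ _ Xu] /and3P[_ _ Xu'].
  by case/(shuffle_factorisation_inj Xu Xu') => /= -> -> ->.
have hA w : (w \in h @: A)%SET = `[< X (rho (n + m)%N w) >].
  apply/imsetP/asboolP => [[[[a b] u]] | Xw].
    rewrite inA /= => /and3P[/asboolP Ea /asboolP Eb Xu] ->.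
    by have [|e Xe /= ->] := sub_X (h (a, b, u)) _; first by exists u, a, b.
  have [|u [a [b [Xu Ea Eb ->]]]] := X_sub w; first by exists (rho _ w).
  exists (a, b, u) => //; rewrite inA /= Xu.
  by rewrite (asboolT Ea) (asboolT Eb).
rewrite (_ : star _ _ =
  \sum_(w : wreath gT (n + m) | `[< X (rho _ w) >]) << coloured w >>).
  exact: E_rho_fibre_union.
rewrite -(eq_bigl _ _ hA) (big_imset _ h_inj) star_b_rho pair_big /=.
rewrite /star_basis /= pair_big_dep /=; apply: eq_bigl => -[[a b] u].
by rewrite inA /= andbA.
Qed.

Theorem corollary3p2 (K : fieldType) (charK0 : [pchar K]%R =i pred0)
    (gT : finGroupType) (abG : abelian [set: gT])
    (E : nat -> Type) (rho : forall n : nat, wreath gT n -> E n)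
    (IP : induction_property rho) :
  is_subalgebra star_one star (E_rho K rho).
Proof.
split; last 2 first.
- exact: E_rhoP.
- move=> x y Ex Ey.
  apply: (E_rho_linear_image (star_linear_l y)) Ex => n en.
  apply: (E_rho_linear_image (star_linear_r _)) Ey => m em.
  exact: E_rho_star_b.
have -> : star_one = b_rho K rho (rho 0%N 1%g); last exact: E_rho_b.
have G0_triv (a : wreath gT 0) : a = 1%g.
  apply: (_ : a = wreath_one gT 0); case: a => s f.
  by congr pair; [apply/permP | apply/ffunP] => -[].
rewrite /b_rho (big_pred1 (1%g : wreath gT 0)) // => a.
by rewrite (G0_triv a) /= eqxx; apply/asboolP.
Qed.
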